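(* Each extended real-valued function on a real vector space is the restriction of some Gerstewitz functional to a hyperspace. In detail: let $Y$ be a real vector space, $f:Y\to\overline{\mathbb{R}}$, $A:=\operatorname{epi}f\subseteq Y\times\mathbb{R}$ and $k:=(0_Y,-1)\in Y\times\mathbb{R}$. Then $\operatorname{dom}f=\{y\in Y:(y,0)\in\operatorname{dom}\varphi_{A,k}\}$ and $f(y)=\varphi_{A,k}((y,0))$ for each $y\in Y$.
   Context: $\overline{\mathbb{R}}=\mathbb{R}\cup\{-\infty,+\infty\}$ and $\inf\emptyset=+\infty$. For $f:Y\to\overline{\mathbb{R}}$, $\operatorname{epi}f=\{(y,t)\in Y\times\mathbb{R}: f(y)\le t\}$ and $\operatorname{dom}f=\{y\in Y: f(y)\in\mathbb{R}\cup\{-\infty\}\}$ (and likewise for functions on $Y\times\mathbb{R}$). For a real vector space $Z$, $A\subseteq Z$ and $k\in Z\setminus\{0\}$, the Gerstewitz functional $\varphi_{A,k}:Z\to\overline{\mathbb{R}}$ is $\varphi_{A,k}(z)=\inf\{t\in\mathbb{R}: z\in A+tk\}$; here $Z=Y\times\mathbb{R}$, and the hyperspace is $Y\times\{0\}$, identified with $Y$. *)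

(* Defs.v *)
From mathcomp Require Import all_boot all_order all_algebra.
From mathcomp Require Import boolp classical_sets reals constructive_ereal ereal.

Set Implicit Arguments.
Unset Strict Implicit.
Unset Printing Implicit Defensive.

Import Order.TTheory GRing.Theory Num.Theory.

Local Open Scope classical_set_scope.
Local Open Scope ring_scope.

(* The product Y x RR is written Y * R^o: R^o is R as a vector space over
   itself. *)

Definition epi (R : realType) (Y : lmodType R) (f : Y -> \bar R) :
    set (Y * R^o) :=
  [set z | (f z.1 <= (z.2 : R)%:E)%E].

Definition edom (R : realType) (T : Type) (f : T -> \bar R) : set T :=
  f @^-1` (range (@EFin R) `|` [set -oo%E]).

Definition translate (R : realType) (Z : lmodType R) (A : set Z) (v : Z) :
    set Z :=
  [set a + v | a in A].

(* ereal_inf set0 = +oo.  The formula makes sense for every k; it is called a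
   Gerstewitz functional only when k != 0. *)
Definition gerstewitz (R : realType) (Z : lmodType R) (A : set Z) (k z : Z) :
    \bar R :=
  ereal_inf [set t%:E | t in [set t : R | z \in translate A (t *: k)]].

(* Maximal proper linear subspace. *)
Definition hyperspace (R : realType) (Z : lmodType R) (H : set Z) : Prop :=
  [/\ submod_closed (mem H), H != setT &
      forall L : set Z, submod_closed (mem L) -> H `<=` L ->
        L = H \/ L = setT].

(* Main.v *)
Require Import Defs.
From mathcomp Require Import all_boot all_order all_algebra.
From mathcomp Require Import boolp classical_sets reals constructive_ereal ereal.

Import Order.TTheory GRing.Theory Num.Theory.

Local Open Scope classical_set_scope.
Local Open Scope ring_scope.

(** Translating by [t *: (0, -1)] lowers the epigraph by [t], so [(y, 0)] lies in the translate
    exactly when [(y, t)] lies in [epi f], that is, when [f y <= t] ([mem_translate_epi]). The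
    functional at [(y, 0)] is thus the infimum of the real upper bounds of [f y], which is [f y]
    even at infinite values ([ereal_inf_EFin_ge]). Equality of the domains follows pointwise. *)

Lemma ereal_inf_EFin_ge (R : realType) (x : \bar R) :
  ereal_inf [set t%:E | t in [set t : R | (x <= t%:E)%E]] = x.
Proof.
apply/eqP; rewrite eq_le; apply/andP; split; last first.
  by apply: le_ereal_inf_tmp => _ [t /= xt <-].
case: x => [r| |].
- by apply: ereal_inf_lbound; exists r => /=.
- exact: leey.
(* Every real bounds [-oo] from above, so the infimum runs over all of [R]. *)
- rewrite -[leRHS](ereal_inf_real R); apply: ereal_inf_le_tmp => _ [t _ <-].
  by exists t; rewrite //= leNye.
Qed.

Lemma mem_translate_epi (R : realType) (Y : lmodType R) (f : Y -> \bar R)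
    (y : Y) (t : R) :
  ((y, 0) \in translate (epi f) (t *: ((0, -1) : Y * R^o))) = (f y <= t%:E)%E.
Proof.
apply/idP/idP.
  rewrite inE => -[[a s] /= fas [<- /eqP]].
  (* Scaling in [R^o] is multiplication, so the second coordinates give [s - t = 0]. *)
  rewrite scaler0 addr0 scalerN [t *: 1]mulr1 subr_eq0 => /eqP <-.
  exact: fas.
move=> fyt; rewrite inE; exists (y, t) => //.
by congr pair; rewrite /= ?scaler0 ?addr0 // scalerN [t *: 1]mulr1 subrr.
Qed.

Lemma gerstewitz_epi (R : realType) (Y : lmodType R) (f : Y -> \bar R) (y : Y) :
  gerstewitz (epi f) ((0, -1) : Y * R^o) (y, 0) = f y.
Proof.
rewrite -[RHS]ereal_inf_EFin_ge /gerstewitz.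
by under eq_set => t do rewrite mem_translate_epi.
Qed.

(** Maximality holds because [Y * {0}] has codimension one: adding any vector [(u, s)] with [s != 0]
    generates the whole space. *)
Lemma hyperspace_setX0 (R : realType) (Y : lmodType R) :
  hyperspace ([set: Y] `*` [set 0] : set (Y * R^o)).
Proof.
split.
- split; first by rewrite inE.
  move=> a [u s] [v t]; rewrite !inE /= => -[_ /= ->] [_ /= ->].
  by split => //=; rewrite scaler0 addr0.
- apply/eqP => H.
  have : ([set: Y] `*` [set 0] : set (Y * R^o)) (0, 1) by rewrite H.
  by case=> _ /= /eqP; rewrite oner_eq0.
- move=> L [L0 Llin] HL.
  have [LH|] := pselect (L `<=` [set: Y] `*` [set 0]).
    by left; apply/seteqP.
  move=> /existsNP[[u s] /not_implyP[Lus /= s0]]; right.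
  have {}s0 : s != 0 by apply/eqP => s0'; apply: s0.
  apply/seteqP; split => // -[v t] _.
  (* The factor [t / s] cancels the second coordinate, leaving a remainder in [Y * {0}], hence in
     [L]. *)
  have -> : (v, t) = (t / s) *: (u, s) + (v - (t / s) *: u, 0) :> Y * R^o.
    congr pair => /=; first by rewrite addrC subrK.
    by rewrite addr0 /GRing.scale /= divfK.
  have := Llin (t / s) (u, s) (v - (t / s) *: u, 0).
  by rewrite !inE; apply => //; apply: HL.
Qed.

Theorem theorem5 (R : realType) (Y : lmodType R) (f : Y -> \bar R) :
  let A : set (Y * R^o) := epi f in
  let k : Y * R^o := (0, -1) in
  [/\ k != 0,
      hyperspace ([set: Y] `*` [set 0] : set (Y * R^o)),
      edom f = [set y : Y | (y, 0) \in edom (gerstewitz A k)] &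
      forall y : Y, f y = gerstewitz A k (y, 0)].
Proof.
split; last by move=> y; rewrite gerstewitz_epi.
- by apply/eqP => -[/eqP]; rewrite oppr_eq0 oner_eq0.
- exact: hyperspace_setX0.
- by apply/seteqP; split => y; rewrite /= inE /edom /= gerstewitz_epi.
Qed.
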